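(* Let $H$ be the graph on vertex set $\{0,1,2,3\}$ with red edge set $\{\{0,2\},\{0,3\}\}$ and blue edge set $\{\{0,1\},\{2,3\}\}$. Then $\lambda_H=1/8$, the semi-inducibility problem for $H$ is perfectly $K_2$-stable, and the unique maximizer of $\lambda_H(K_2(\mathbf a))$ over vectors $\mathbf a$ of two non-negative reals summing to $1$ is $\mathbf a=(1/2,1/2)$.
   Context: All graphs are finite and simple; the order of a graph is its number of vertices. For a graph $H$ with $\kappa$ vertices whose edges are coloured red or blue and an uncoloured graph $G$ of order $n\ge\kappa$, an embedding of $H$ into $G$ is an injection $V(H)\to V(G)$ that maps red edges of $H$ to edges of $G$ and blue edges of $H$ to non-edges of $G$ (pairs of distinct non-adjacent vertices). $\Lambda_H(G)$ is the number of embeddings, $\lambda_H(G):=\Lambda_H(G)/\big(n(n-1)\cdots(n-\kappa+1)\big)$, $\lambda_H(n)$ is the maximum of $\lambda_H(G)$ over all graphs $G$ of order $n$, and $\lambda_H:=\lim_{n\to\infty}\lambda_H(n)$ (the limit exists). For a graph $B$ on $\{0,\dots,m-1\}$ and pairwise disjoint finite sets $V_0,\dots,V_{m-1}$ (some possibly empty), the blowup $B(V_0,\dots,V_{m-1})$ is the graph on $\bigcup_i V_i$ in which $x\in V_i$ and $y\in V_j$ are adjacent if and only if $\{i,j\}\in E(B)$. For a vector $\mathbf a=(a_0,\dots,a_{m-1})$ of non-negative reals summing to $1$, $\lambda_H(B(\mathbf a))$ denotes the limit as $n\to\infty$ of $\lambda_H(B(V_0,\dots,V_{m-1}))$ where $\sum_i|V_i|=n$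 and $|V_i|=(a_i+o(1))n$. Equivalently, it is $\sum_f\prod_{i\in V(H)}a_{f(i)}$, the sum being over all maps $f:V(H)\to V(B)$ sending every red edge of $H$ to an edge of $B$ and every blue edge to a non-edge of $B$ or to two equal vertices. The edit distance $\delta_{\mathrm{edit}}(G,G')$ between two graphs of the same order is the minimum of $|f(E(G))\bigtriangleup E(G')|$ over all bijections $f:V(G)\to V(G')$. The semi-inducibility problem for $H$ is perfectly $B$-stable if there is $C>0$ such that for every graph $G$ of order $n\ge C$ there is a blowup $G'$ of $B$ of order $n$ with $\delta_{\mathrm{edit}}(G,G')\le C\,(\lambda_H(n)-\lambda_H(G))\,n^2$. (Here $C\ge\kappa$ may be assumed.) *)

(* Defs.v *)
From HB Require Import structures.
From mathcomp Require Import all_boot all_order all_algebra.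
From mathcomp Require Import fingroup perm.
From mathcomp Require Import all_classical all_reals all_analysis.
Set Implicit Arguments.
Unset Strict Implicit.
Unset Printing Implicit Defensive.
Import Order.TTheory GRing.Theory Num.Theory.
Import numFieldNormedType.Exports.
Local Open Scope ring_scope.

Record graph (T : finType) := Graph {
  edges :> {set {set T}};
  edgesP : [forall e in edges, #|e| == 2%N]
}.

HB.instance Definition _ (T : finType) := [isSub for @edges T].
HB.instance Definition _ (T : finType) := [Finite of graph T by <:].

Definition adj (T : finType) (G : graph T) (x y : T) : bool :=
  [set x; y] \in edges G.

Lemma adjC (T : finType) (G : graph T) x y : adj G x y = adj G y x.
Proof. by rewrite /adj finset.setUC. Qed.

Lemma adjxx (T : finType) (G : graph T) x : adj G x x = false.
Proof.
apply/negP => h; have := edgesP G => /forall_inP /(_ _ h).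
by rewrite cards2 eqxx.
Qed.

Lemma complete_subproof (T : finType) :
  [forall e in [set e : {set T} | #|e| == 2%N], #|e| == 2%N].
Proof. by apply/forall_inP => e; rewrite inE. Qed.

Definition complete (T : finType) : graph T := Graph (complete_subproof T).

(* The parts V_i of the blowup are the fibres of p, hence automatically
   disjoint and possibly empty. *)
Lemma blowup_subproof (W T : finType) (B : graph W) (p : T -> W) :
  [forall e in [set e : {set T} | (#|e| == 2%N) && (p @: e \in edges B)],
     #|e| == 2%N].
Proof. by apply/forall_inP => e; rewrite inE => /andP[]. Qed.

Definition blowup (W T : finType) (B : graph W) (p : T -> W) : graph T :=
  Graph (blowup_subproof B p).

Lemma adj_blowup (W T : finType) (B : graph W) (p : T -> W) x y :
  adj (blowup B p) x y = adj B (p x) (p y).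
Proof.
rewrite /adj inE imsetU1 imset_set1 cards2.
have [->|//] := eqVneq x y.
by rewrite -/(adj B (p y) (p y)) adjxx.
Qed.

Record cgraph (V : finType) := CGraph {
  red : graph V;
  blue : graph V;
  red_blue_disjoint : [disjoint edges red & edges blue]
}.

(* Blue edges are sent to non-edges between distinct vertices because f is
   injective. *)
Definition embeddings (V T : finType) (H : cgraph V) (G : graph T) :
    {set {ffun V -> T}} :=
  [set f : {ffun V -> T} | [&& injectiveb f,
     [forall x, forall y, adj (red H) x y ==> adj G (f x) (f y)] &
     [forall x, forall y, adj (blue H) x y ==> ~~ adj G (f x) (f y)]]].

Definition density (R : realType) (V T : finType) (H : cgraph V)
    (G : graph T) : R :=
  #|embeddings H G|%:R / (#|T| ^_ #|V|)%:R.

(* Densities are nonnegative, so the neutral element 0 does not alter the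
   maximum. *)
Definition max_density (R : realType) (V : finType) (H : cgraph V) (n : nat)
    : R :=
  \big[Num.max/0]_(G : graph 'I_n) density R H G.

Definition edit_cost (T : finType) (G G' : graph T) (s : {perm T}) : nat :=
  let sG := [set s @: (e : {set T}) | e in edges G] in
  #|(sG :\: edges G') :|: (edges G' :\: sG)|.

Definition edit_distance (T : finType) (G G' : graph T) : nat :=
  \big[minn/edit_cost G G' 1%g]_(s : {perm T}) edit_cost G G' s.

(* Requiring #|V| <= C costs nothing, since C may be increased; it keeps n in
   the range where the densities are meaningful. *)
Definition perfectly_stable (R : realType) (V W : finType) (H : cgraph V)
    (B : graph W) : Prop :=
  exists C : R, [/\ 0 < C, #|V|%:R <= C &
    forall (n : nat) (G : graph 'I_n), C <= n%:R ->
    exists p : 'I_n -> W,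
      (edit_distance G (blowup B p))%:R
        <= C * (max_density R H n - density R H G) * n%:R ^+ 2].

Definition simplex (R : realType) (m : nat) : set 'rV[R]_m :=
  [set a : 'rV[R]_m | (forall i, 0 <= a 0 i) /\ \sum_i a 0 i = 1]%classic.
Arguments simplex R m : clear implicits.

Definition fibre_size (n m : nat) (p : 'I_n -> 'I_m) (i : 'I_m) : nat :=
  #|[pred x | p x == i]|.

(* |V_i| = (a_i + o(1)) n for the parts V_i of the blowup given by p n. *)
Definition has_fibre_limits (R : realType) (m : nat) (a : 'rV[R]_m)
    (p : forall n : nat, 'I_n -> 'I_m) : Prop :=
  forall i : 'I_m,
    (((fibre_size (p n) i)%:R / n%:R)%R @[n --> \oo] --> a 0%R i)%classic.

Definition is_blowup_density (R : realType) (V : finType) (m : nat)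
    (H : cgraph V) (B : graph 'I_m) (a : 'rV[R]_m) (l : R) : Prop :=
  forall p : (forall n : nat, 'I_n -> 'I_m), has_fibre_limits a p ->
    (density R H (blowup B (p n)) @[n --> \oo] --> l)%classic.

(* For a in the simplex the limit exists and is unique: see
   is_blowup_densityP and blowup_densityE below. *)
Definition blowup_density (R : realType) (V : finType) (m : nat)
    (H : cgraph V) (B : graph 'I_m) (a : 'rV[R]_m) : R :=
  get [set l | is_blowup_density H B a l]%classic.

Definition maximizers (R : realType) (X : Type) (F : X -> R) (S : set X)
    : set X :=
  [set x | S x /\ forall y, S y -> F y <= F x]%classic.

Definition blowup_maps (V W : finType) (H : cgraph V) (B : graph W) :
    {set {ffun V -> W}} :=
  [set f : {ffun V -> W} |
     [forall x, forall y, adj (red H) x y ==> adj B (f x) (f y)] &&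
     [forall x, forall y, adj (blue H) x y ==> ~~ adj B (f x) (f y)]].

Definition blowup_poly (R : realType) (V : finType) (m : nat)
    (H : cgraph V) (B : graph 'I_m) (a : 'rV[R]_m) : R :=
  \sum_(f in blowup_maps H B) \prod_x a 0 (f x).

Section BlowupDensity.
Variables (R : realType) (V : finType) (m : nat) (H : cgraph V).
Variables (B : graph 'I_m) (a : 'rV[R]_m).

Definition pullback_maps (n : nat) (p : 'I_n -> 'I_m) :
    {set {ffun V -> 'I_n}} :=
  [set g : {ffun V -> 'I_n} | [ffun x => p (g x)] \in blowup_maps H B].

Lemma card_pullback_maps (n : nat) (p : 'I_n -> 'I_m) :
  #|pullback_maps p| =
    (\sum_(f in blowup_maps H B) \prod_x fibre_size p (f x))%N.
Proof.
rewrite -sum1_card.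
rewrite (partition_big (fun g : {ffun V -> 'I_n} => [ffun x => p (g x)])
  (mem (blowup_maps H B))) /=; last by move=> g; rewrite inE.
apply: eq_bigr => f fB; rewrite sum1dep_card.
pose F x := [pred y | p y == f x].
have key (g : {ffun V -> 'I_n}) :
    (g \in family F) = ([ffun x => p (g x)] == f).
  apply/familyP/eqP => [h|fE x]; last by rewrite inE -fE ffunE.
  by apply/ffunP => x; rewrite ffunE; apply/eqP; have := h x; rewrite inE.
transitivity #|(family F : simpl_pred {ffun V -> 'I_n})|.
  apply: eq_card => g; rewrite [RHS]key [LHS]inE [_ \in pullback_maps p]inE.
  by case: eqP => [->|_]; rewrite ?andbF// fB.
by rewrite card_family foldrE big_map big_enum.
Qed.

Lemma embeddings_blowup (n : nat) (p : 'I_n -> 'I_m) :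
  embeddings H (blowup B p) =
    pullback_maps p :&: [set f : {ffun V -> 'I_n} | injectiveb f].
Proof.
apply/setP => g; rewrite !inE andbC; congr andb.
by congr andb; apply: eq_forallb => x; apply: eq_forallb => y;
  rewrite adj_blowup !ffunE.
Qed.

Lemma card_embeddings_blowup (n : nat) (p : 'I_n -> 'I_m) :
  (#|pullback_maps p| + n ^_ #|V| <=
     #|embeddings H (blowup B p)| + n ^ #|V|)%N /\
  (#|embeddings H (blowup B p)| <= #|pullback_maps p|)%N.
Proof.
rewrite embeddings_blowup; split; last exact/subset_leq_card/finset.subsetIl.
set I := [set f | _]; have -> : (n ^_ #|V| = #|I|)%N.
  by rewrite card_inj_ffuns card_ord.
rewrite -cardsUI addnC leq_add2l.
by rewrite (leq_trans (max_card _))// card_ffun card_ord.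
Qed.

Lemma cvg_invn : ((n%:R^-1)%R @[n --> \oo] --> (0 : R)%R)%classic.
Proof. by rewrite -cvg_shiftS; exact: cvg_harmonic. Qed.

Lemma cvg_ffact_ratio (k : nat) :
  (((n ^_ k)%:R / n%:R ^+ k)%R @[n --> \oo] --> (1 : R)%R)%classic.
Proof.
elim: k => [|k IH].
  apply: cvg_near_cst; near=> n.
  by rewrite expr0 divr1 ffactn0.
have h : (((n ^_ k)%:R / n%:R ^+ k * (1 - k%:R * n%:R^-1))%R
    @[n --> \oo] --> (1 * (1 - k%:R * 0) : R)%R)%classic.
  apply: cvgM IH _; apply: cvgB; first exact: cvg_cst.
  by apply: cvgM cvg_invn; exact: cvg_cst.
rewrite mulr0 subr0 mulr1 in h; apply: cvg_trans h.
apply: near_eq_cvg; near=> n.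
have n0 : n%:R != 0 :> R by rewrite pnatr_eq0 -lt0n; near: n; exact: nbhs_infty_gt.
have kn : (k <= n)%N by near: n; exact: nbhs_infty_ge.
rewrite ffactnSr natrM natrB// exprSr invfM mulrACA; congr (_ * _).
by rewrite mulrBl divff.
Unshelve. all: by end_near. Qed.

Lemma cvg_pullback (p : forall n : nat, 'I_n -> 'I_m) :
  has_fibre_limits a p ->
  ((#|pullback_maps (p n)|%:R / n%:R ^+ #|V|)%R @[n --> \oo]
     --> blowup_poly H B a)%classic.
Proof.
move=> pa.
have -> : (fun n => #|pullback_maps (p n)|%:R / n%:R ^+ #|V| : R) =
    (fun n => \sum_(f in blowup_maps H B)
        \prod_x ((fibre_size (p n) (f x))%:R / n%:R)).
  apply/funext => n; rewrite card_pullback_maps natr_sum mulr_suml.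
  apply: eq_bigr => f _; rewrite natr_prod.
  by rewrite big_split /= prodr_const exprVn.
rewrite /blowup_poly; apply: cvg_big; first exact: add_continuous.
by move=> f _; apply: cvg_big; [exact: mul_continuous|move=> x _; exact: pa].
Qed.

Lemma is_blowup_density_poly :
  is_blowup_density H B a (blowup_poly H B a).
Proof.
move=> p pa; have hM := cvg_pullback pa.
have hr := cvg_ffact_ratio #|V|.
set M := (fun n => _) in hM; set r := (fun n => _) in hr.
have r1 : (1 : R) != 0 by exact: oner_neq0.
have hV : ((r n)^-1%R @[n --> \oo] --> (1^-1 : R)%R)%classic by exact: cvgV.
have hup : ((M n * (r n)^-1)%R @[n --> \oo]
    --> (blowup_poly H B a * 1^-1)%R)%classic by exact: cvgM.
have hlow : (((M n + r n - 1) * (r n)^-1)%R @[n --> \oo]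
    --> ((blowup_poly H B a + 1 - 1) * 1^-1)%R)%classic.
  by apply: cvgM hV; apply: cvgB; [exact: cvgD|exact: cvg_cst].
rewrite addrK in hlow; rewrite invr1 mulr1 in hlow hup.
apply: (squeeze_cvgr _ hlow hup); near=> n.
have n0 : (0 < n%:R ^+ #|V| :> R).
  by rewrite exprn_gt0// ltr0n; near: n; exact: nbhs_infty_gt.
have f0 : (0 < (n ^_ #|V|)%:R :> R).
  by rewrite ltr0n ffact_gt0; near: n; exact: nbhs_infty_ge.
have [lo up] := card_embeddings_blowup (p n).
have rV : (r n)^-1 = n%:R ^+ #|V| / (n ^_ #|V|)%:R by rewrite /r invf_div.
rewrite /density card_ord; apply/andP; split.
  rewrite rV mulrA ler_pM2r ?invr_gt0//.
  rewrite mulrBl mulrDl mul1r /M /r !divfK ?gt_eqF//.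
  by rewrite lerBlDr -natrX -!natrD ler_nat.
by rewrite rV mulrA /M divfK ?gt_eqF// ler_pM2r ?invr_gt0// ler_nat.
Unshelve. all: by end_near. Qed.

Lemma ex_map_fibre_size (n : nat) (v : 'I_m -> nat) :
  (\sum_i v i = n)%N ->
  exists p : 'I_n -> 'I_m, forall i, fibre_size p i = v i.
Proof.
move=> vn; pose S := {i : 'I_m & 'I_(v i)}.
have cS : #|{: S}| = n.
  rewrite card_tagged -vn sumnE big_map big_enum /=.
  by apply: eq_bigr => i _; rewrite card_ord.
pose g (x : 'I_n) : S := enum_val (cast_ord (esym cS) x).
have g_bij : bijective g.
  apply: bij_comp; first exact: enum_val_bij.
  by exists (cast_ord cS); [exact: cast_ordKV|exact: cast_ordK].
exists (fun x => tag (g x)) => i; rewrite /fibre_size -sum1_card.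
transitivity (\sum_(u : S | tag u == i) 1)%N.
  by rewrite [RHS](reindex g) //; exact: onW_bij.
have := @sig_big_dep _ 0%N addn _ _ (pred1 i) (fun j (_ : 'I_(v j)) => true)
  (fun j (_ : 'I_(v j)) => 1%N).
under [in RHS]eq_bigl do rewrite andbT.
by move=> <-; rewrite big_pred1_eq sum1_card card_ord.
Qed.

Lemma cvg_truncn_ratio (x : R) : 0 <= x ->
  (((Num.truncn (x * n%:R))%:R / n%:R)%R @[n --> \oo] --> x)%classic.
Proof.
move=> x0.
have hlow : ((x - n%:R^-1)%R @[n --> \oo] --> (x - 0)%R)%classic.
  by apply: cvgB cvg_invn; exact: cvg_cst.
rewrite subr0 in hlow.
apply: squeeze_cvgr hlow (cvg_cst x); near=> n.
have n0 : (0 < n%:R :> R) by rewrite ltr0n; near: n; exact: nbhs_infty_gt.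
have /truncn_itv/andP[lo up] : 0 <= x * n%:R by rewrite mulr_ge0// ltW.
rewrite ler_pdivlMr// ler_pdivrMr// lo andbT mulrBl mulVf ?gt_eqF//.
by rewrite lerBlDr natr1 ltW.
Unshelve. all: by end_near. Qed.

Lemma ex_fibre_limits : simplex R m a ->
  exists p : forall n : nat, 'I_n -> 'I_m, has_fibre_limits a p.
Proof.
move=> [a0 a1].
have [i0 _|m0] := pickP 'I_m; last first.
  by move: a1; rewrite big_pred0 => // /esym/eqP; rewrite oner_eq0.
pose w n i := Num.truncn (a 0 i * n%:R).
have wn n : (\sum_(i | i != i0) w n i <= n)%N.
  rewrite -(ler_nat R) natr_sum.
  apply: (@le_trans _ _ (\sum_(i | i != i0) a 0 i * n%:R)).
    by apply: ler_sum => i _; rewrite truncn_le mulr_ge0.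
  rewrite -mulr_suml ler_piMl// -a1 [leRHS](bigD1 i0)//=.
  by rewrite lerDr.
pose v n i := if i == i0 then (n - \sum_(j | j != i0) w n j)%N else w n i.
have vn n : (\sum_i v n i = n)%N.
  rewrite (bigD1 i0)//= {1}/v eqxx -[RHS](subnK (wn n)); congr addn.
  by apply: eq_bigr => i /negPf ii0; rewrite /v ii0.
pose p n := sval (cid (ex_map_fibre_size (vn n))).
have hp n : forall i, fibre_size (p n) i = v n i := svalP (cid (ex_map_fibre_size (vn n))).
have wlim i : (((w n i)%:R / n%:R)%R @[n --> \oo] --> a 0%R i)%classic.
  exact: cvg_truncn_ratio.
exists p => i; under eq_fun do rewrite hp.
have [->|ii0] := eqVneq i i0; last first.
  by under eq_fun do rewrite /v (negPf ii0); exact: wlim.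
have h : ((1 - \sum_(j | j != i0) (w n j)%:R / n%:R)%R @[n --> \oo]
    --> (1 - \sum_(j | j != i0) a 0 j)%R)%classic.
  apply: cvgB; first exact: cvg_cst.
  by apply: cvg_big; [exact: add_continuous|move=> j _; exact: wlim].
have aE : 1 - \sum_(j | j != i0) a 0 j = a 0 i0.
  by rewrite -a1 [X in (X - _)%R](bigD1 i0)//= addrK.
rewrite aE in h.
apply: cvg_trans h; apply: near_eq_cvg; near=> n.
have n0 : n%:R != 0 :> R.
  by rewrite pnatr_eq0 -lt0n; near: n; exact: nbhs_infty_gt.
by rewrite /v eqxx natrB// natr_sum mulrBl divff// mulr_suml.
Unshelve. all: by end_near. Qed.

Lemma is_blowup_densityP (l : R) : simplex R m a ->
  is_blowup_density H B a l <-> l = blowup_poly H B a.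
Proof.
move=> /ex_fibre_limits[p pa]; split=> [h|->]; last exact: is_blowup_density_poly.
apply: (@norm_cvg_unique _ R^o _ _ _ _ (h p pa)).
exact: is_blowup_density_poly.
Qed.

Lemma blowup_densityE : simplex R m a ->
  blowup_density H B a = blowup_poly H B a.
Proof.
move=> sa; apply/(is_blowup_densityP _ sa).
exact: (getI (is_blowup_density_poly)).
Qed.

End BlowupDensity.


Section PawDef.
Local Notation v i := (inord i : 'I_4).

Definition paw_red_edges : {set {set 'I_4}} :=
  [set [set v 0; v 2]; [set v 0; v 3]].

Definition paw_blue_edges : {set {set 'I_4}} :=
  [set [set v 0; v 1]; [set v 2; v 3]].

Lemma paw_red_subproof : [forall e in paw_red_edges, #|e| == 2%N].
Proof.
by apply/forall_inP => e /set2P[]->; rewrite cards2 -val_eqE /= !inordK.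
Qed.

Lemma paw_blue_subproof : [forall e in paw_blue_edges, #|e| == 2%N].
Proof.
by apply/forall_inP => e /set2P[]->; rewrite cards2 -val_eqE /= !inordK.
Qed.

Lemma paw_disjoint_subproof :
  [disjoint edges (Graph paw_red_subproof) & edges (Graph paw_blue_subproof)].
Proof.
apply/pred0P => e /=; apply/negP => /andP[/set2P he /set2P he'].
have [h2|h3] : v 2 \in e /\ v 0 \in e \/ v 3 \in e /\ v 0 \in e.
  by case: he => ->; [left|right]; rewrite !inE !eqxx ?orbT.
- case: he' => hE; move: h2; rewrite hE !inE -!val_eqE /= !inordK //; by case.
- case: he' => hE; move: h3; rewrite hE !inE -!val_eqE /= !inordK //; by case.
Qed.

Definition coloured_paw : cgraph 'I_4 := CGraph paw_disjoint_subproof.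

End PawDef.

(* Main.v *)
Require Import Defs.
From mathcomp Require Import all_boot all_order all_algebra.
From mathcomp Require Import all_classical all_reals all_analysis.
From mathcomp Require Import fingroup perm.
From mathcomp Require Import ring lra zify.
Import Order.TTheory GRing.Theory Num.Theory.
Import numFieldNormedType.Exports.
Local Open Scope ring_scope.
Set Implicit Arguments.
Unset Strict Implicit.
Unset Printing Implicit Defensive.

(** Let d be the degree function of G and t(x,y) the codegree. The number of
    embeddings is the sum over ordered edges (x,y) of
      (n-1-d(x)) (d(x)-1-t(x,y)),
    and t(x,y) >= max(0, d(x)+d(y)-n). After symmetrising, each edge contributes
    at most (M/2)(1/d(x) + 1/d(y)) - c n (|d(x)+d(y)-n| + t(x,y)), where nM is the
    number of embeddings into the balanced complete bipartite graph. Since the sum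
    of 1/d(x) over ordered edges is the number of non-isolated vertices, this
    gives the exact maximum, and the deficit of G controls the sum over edges of
    the defect |d(x)+d(y)-n| + t(x,y).

    For stability, take an edge (x,y) and the bipartition into N(y) and its
    complement: every pair on which G differs from the complete bipartite graph
    is charged to the defect of (x,y) or of edges at x or y. Averaging over the
    edges, of which there are at least a constant times n^2 unless the deficit
    is of order n^4, yields a suitable y. *)

(** * The inequality for a single edge *)

Section EdgeInequality.
Variable F : realFieldType.
Implicit Types n a b t X P : F.

(* Only for a + b = n is the bound tight, so only there is the exact value
   P * (P - n + 1) of X needed; elsewhere a lower bound on X that holds for both
   parities of n suffices. *)
Lemma edge_ineq_eq n a b t P : 3 <= n -> 1 <= a -> 1 <= b -> a + b = n ->
  0 <= t -> a * b <= P ->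
  (n - 1 - a) * (a - 1 - t) + (n - 1 - b) * (b - 1 - t)
    + n / 40 * (`|a + b - n| + t)
  <= 2 * (P * (P - n + 1)) / n * (a^-1 + b^-1).
Proof.
move=> n3 a1 b1 s t0 pP.
have a0 : 0 < a by lra.
have b0 : 0 < b by lra.
have n0 : 0 < n by lra.
have p0 : 0 < a * b by exact: mulr_gt0.
have pn : 0 <= a * b - n + 1.
  have hh : 0 <= (a - 1) * (b - 1) by (apply: mulr_ge0; lra).
  by lra.
have E : 2 * (P * (P - n + 1)) / n * (a^-1 + b^-1) = 2 * (P * (P - n + 1)) / (a * b).
  by rewrite -s; field; rewrite !gt_eqF //=; lra.
rewrite E s subrr normr0 add0r ler_pdivlMr //.
have le1 : (a * b) * (a * b - n + 1) <= P * (P - n + 1).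
  by apply: ler_pM => //; [exact: ltW | lra].
(* Since n - 1 - a = b - 1, the two products add up to 2(a - 1)(b - 1) at t = 0, and the total
   coefficient of t, namely n/40 - (n - 2), is negative. *)
have le2 : (n - 1 - a) * (a - 1 - t) + (n - 1 - b) * (b - 1 - t) + n / 40 * t <=
   2 * (a * b - n + 1).
  have nt : 0 <= n * t by apply: mulr_ge0 => //; lra.
  have -> : b = n - a by lra.
  have h : 0 <= (n - 3) * t by apply: mulr_ge0; lra.
  by lra.
apply: le_trans (_ : 2 * (a * b - n + 1) * (a * b) <= _); last by lra.
by rewrite ler_pM2r.
Qed.

(** Convexity reduces both sides to functions of a + b: 1/a + 1/b >= 4/(a + b) on the right, a^2 +
    b^2 >= (a + b)^2 / 2 on the left. *)
Lemma edge_ineq_lt n a b t X : 40 <= n -> 1 <= a -> 1 <= b -> a + b <= n - 1 ->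
  0 <= t -> (n ^+ 2 - 1) * (n - 1) * (n - 3) <= 16 * X ->
  (n - 1 - a) * (a - 1 - t) + (n - 1 - b) * (b - 1 - t)
    + n / 40 * (`|a + b - n| + t)
  <= 2 * X / n * (a^-1 + b^-1).
Proof.
move=> n3 a1 b1 s t0 hX.
have a0 : 0 < a by lra.
have b0 : 0 < b by lra.
have n0 : 0 < n by lra.
have p0 : 0 < a * b by exact: mulr_gt0.
have s0 : 0 < a + b by lra.
have X0 : 0 <= X.
  suff : 0 <= (n ^+ 2 - 1) * (n - 1) * (n - 3) by lra.
  by rewrite !mulr_ge0 //; nra.
have E : 2 * X / n * (a^-1 + b^-1) = 2 * X / n * ((a + b) / (a * b)).
  by congr (_ * _); field; rewrite !gt_eqF.
have F1 : 4 / (a + b) <= (a + b) / (a * b).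
  rewrite ler_pdivrMr // mulrAC ler_pdivlMr //.
  by have := sqr_ge0 (a - b); lra.
rewrite E.
apply: (@le_trans _ _ (2 * X / n * (4 / (a + b)))); last first.
  by apply: ler_wpM2l => //; rewrite !mulr_ge0 // invr_ge0 ltW.
have -> : 2 * X / n * (4 / (a + b)) = 8 * X / (n * (a + b)).
  by field; rewrite !gt_eqF.
rewrite ler_pdivlMr; last exact: mulr_gt0.
rewrite ler0_norm; last lra.
set s' := a + b in s s0 *.
set A' := n * s' - s' ^+ 2 / 2 - 2 * n + 2 + n * (n - s') / 40.
have le1 : (n - 1 - a) * (a - 1 - t) + (n - 1 - b) * (b - 1 - t)
    + n / 40 * (- (s' - n) + t) <= A'.
  have h1 : 0 <= (2 * n - 2 - s' - n / 40) * t by (apply: mulr_ge0; lra).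
  have h2 : 0 <= (a - b) ^+ 2 by exact: sqr_ge0.
  by rewrite /A' /s' in h1 *; lra.
apply: (@le_trans _ _ (A' * (n * s'))).
  by rewrite ler_pM2r // mulr_gt0.
(* [A' * (n * s')] is n^2 (n - 2)^2 / 2 minus the quantities of [k1], half of [k2], and n^2 (n -
   s'). As n - s' >= 1, the last one is at least n^2, which covers half the gap between n^2 (n -
   2)^2 and (n^2 - 1)(n - 1)(n - 3). *)
have k1 : 0 <= n * (n - s') * ((n - 2) ^+ 2 / 2 - s' * n / 40 - n).
  rewrite mulr_ge0 //; first by rewrite mulr_ge0 //; lra.
  have h1 : 0 <= (n - 40) * n by (rewrite mulr_ge0 //; lra).
  have h2 : 0 <= n * (n - s') by (rewrite mulr_ge0 //; lra).
  by lra.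
have k2 : 0 <= n * (n - s') * (n * s' - s' ^+ 2).
  by rewrite !mulr_ge0 //; nra.
have k3 : 0 <= n * n * (n - s' - 1) by rewrite !mulr_ge0 //; lra.
rewrite /A'.
by lra.
Qed.

(** Writing t = j + r with j = a + b - n turns both products into (n - 1 - a)(n - 1 - b) minus a
    multiple of r. On the right a + b = n + j leaves the surplus 2Xj/n, over ab, which pays for the
    defect term; n j / 10 separates the two. *)
Lemma edge_ineq_gt n a b t X : 80 <= n -> a <= n - 1 -> b <= n - 1 ->
  n + 1 <= a + b -> a + b - n <= t -> t <= n ->
  (n ^+ 2 - 1) * (n - 1) * (n - 3) <= 16 * X ->
  (n - 1 - a) * (a - 1 - t) + (n - 1 - b) * (b - 1 - t)
    + n / 40 * (`|a + b - n| + t)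
  <= 2 * X / n * (a^-1 + b^-1).
Proof.
move=> n3 a1 b1 s t0 tn hX.
have a0 : 0 < a by lra.
have b0 : 0 < b by lra.
have n0 : 0 < n by lra.
have p0 : 0 < a * b by exact: mulr_gt0.
pose j := a + b - n; pose r := t - j; pose c := (n - 1 - a) * (n - 1 - b).
have j1 : 1 <= j by rewrite /j; lra.
have r0 : 0 <= r by rewrite /r /j; lra.
have rn : r <= n by rewrite /r; lra.
have c0 : 0 <= c by rewrite /c mulr_ge0 //; lra.
have E : 2 * X / n * (a^-1 + b^-1) = (2 * X + 2 * X * j / n) / (a * b).
  by rewrite /j; field; rewrite !gt_eqF.
have L : (n - 1 - a) * (a - 1 - t) + (n - 1 - b) * (b - 1 - t)
    + n / 40 * (`|a + b - n| + t) =
    2 * c - (n - 2 - j) * r + n / 40 * (2 * j + r).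
  by rewrite ger0_norm /c /r /j; [field | lra].
rewrite L E.
have c4 : 4 * c <= (n - 2 - j) ^+ 2.
  by rewrite /c /j; have := sqr_ge0 (a - b); lra.
have p4 : 4 * (a * b) <= (n + j) ^+ 2.
  by rewrite /j; have := sqr_ge0 (a - b); lra.
have jn : j <= n - 2 by rewrite /j; lra.
(* By AM-GM, 16 c a b <= ((n - 2 - j)(n + j))^2; this decreases in j, so j = 1 is the extreme
   case. *)
have cp : c * (a * b) <= X.
  have h1 : 16 * (c * (a * b)) <= ((n - 2 - j) * (n + j)) ^+ 2.
    rewrite exprMn (_ : 16 * _ = (4 * c) * (4 * (a * b))); last ring.
    by apply: ler_pM => //; rewrite mulr_ge0 // ltW.
  have h2 : (n - 2 - j) * (n + j) <= (n - 3) * (n + 1).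
    have hh : 0 <= (j - 1) * (j + 3) by (rewrite mulr_ge0 //; lra).
    by lra.
  have h3 : ((n - 2 - j) * (n + j)) ^+ 2 <= ((n - 3) * (n + 1)) ^+ 2.
    by rewrite ler_pXn2r // nnegrE mulr_ge0 //; lra.
  have h4 : ((n - 3) * (n + 1)) ^+ 2 <= (n ^+ 2 - 1) * (n - 1) * (n - 3).
    have : 0 <= (n - 3) * (n + 1) by (rewrite mulr_ge0 //; lra).
    by lra.
  by lra.
have Xn : n ^+ 4 <= 20 * X.
  have : 0 <= n ^+ 3 * (n - 80) by (rewrite mulr_ge0 ?exprn_ge0 //; lra).
  have : 0 <= n ^+ 2 by (rewrite exprn_ge0 //; lra).
  have : 0 <= n ^+ 3 by (rewrite exprn_ge0 //; lra).
  by lra.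
have pn : a * b <= n ^+ 2 by rewrite expr2; apply: ler_pM; lra.
have K : n * j / 10 * (a * b) <= 2 * X * j / n.
  rewrite ler_pdivlMr //.
  apply: (@le_trans _ _ (n * j / 10 * n ^+ 2 * n)).
    by rewrite ler_pM2r // ler_wpM2l // !mulr_ge0 //; lra.
  have hh : 0 <= j * (20 * X - n ^+ 4) by (rewrite mulr_ge0 //; lra).
  by lra.
rewrite ler_pdivlMr //.
have k1 : - (n - 2 - j) * r + n / 40 * (2 * j + r) <= n * j / 10.
  have h1 : 0 <= (n - r) * j by (rewrite mulr_ge0 //; lra).
  have h2 : 0 <= r * (n - 2 - j) by (rewrite mulr_ge0 //; lra).
  have h3 : 0 <= r * (n - 80) by (rewrite mulr_ge0 //; lra).
  by lra.
have : (- (n - 2 - j) * r + n / 40 * (2 * j + r)) * (a * b) <= n * j / 10 * (a * b).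
  by rewrite ler_pM2r.
by lra.
Qed.
End EdgeInequality.

(** * Counting embeddings over ordered edges *)

Lemma eq_set2 (U : finType) (x y a b : U) :
  [set x; y] = [set a; b] -> (x = a /\ y = b) \/ (x = b /\ y = a).
Proof.
move=> e.
have: x \in [set a; b] by rewrite -e set21.
have: y \in [set a; b] by rewrite -e set22.
have: a \in [set x; y] by rewrite e set21.
have: b \in [set x; y] by rewrite e set22.
by move=> /set2P hb /set2P ha /set2P [] hy /set2P [] hx; subst; auto;
  case: ha => ?; case: hb => ?; subst; auto.
Qed.

Lemma coloured_paw_edges :
  [/\ adj (red coloured_paw) (inord 0) (inord 2),
      adj (red coloured_paw) (inord 0) (inord 3),
      adj (blue coloured_paw) (inord 0) (inord 1) &
      adj (blue coloured_paw) (inord 2) (inord 3)].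
Proof. by rewrite /adj /= !inE !eqxx ?orbT. Qed.

Definition nbrs (T : finType) (G : graph T) (x : T) : {set T} :=
  [set y | adj G x y].

Definition codeg (T : finType) (G : graph T) (x y : T) : nat :=
  #|nbrs G x :&: nbrs G y|.

Section Counting.
Variables (T : finType) (G : graph T).
Local Notation N := (nbrs G).
Local Notation v i := (inord i : 'I_4).

Lemma in_nbrs x y : (y \in N x) = adj G x y.
Proof. by rewrite inE. Qed.

Lemma nbrsC x y : (y \in N x) = (x \in N y).
Proof. by rewrite !inE adjC. Qed.

Lemma codegC x y : codeg G x y = codeg G y x.
Proof. by rewrite /codeg finset.setIC. Qed.

(** On the uncoloured pairs {1,2} and {1,3} injectivity is automatic: the images of 2 and 3 are
    neighbours of the image of 0, that of 1 is not. *)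
Lemma embeddings_pawP (f : {ffun 'I_4 -> T}) :
  (f \in embeddings coloured_paw G) =
  [&& f (v 2) \in N (f (v 0)), f (v 1) \in ~: (f (v 0) |: N (f (v 0))) &
      f (v 3) \in N (f (v 0)) :\: (f (v 2) |: N (f (v 2)))].
Proof.
have hv (i j : nat) : (i < 4)%N -> (j < 4)%N -> (v i == v j) = (i == j).
  by move=> hi hj; rewrite -val_eqE /= !inordK.
rewrite !inE; apply/and3P/and3P.
  move=> [/injectiveP finj /forallP hr /forallP hb].
  have [e02 e03 e01 e23] := coloured_paw_edges.
  rewrite (implyP (forallP (hr _) _) e02) (implyP (forallP (hr _) _) e03).
  rewrite (negPf (implyP (forallP (hb _) _) e01)) (negPf (implyP (forallP (hb _) _) e23)).
  by rewrite !(inj_eq finj) !hv.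
move=> [r02]; rewrite negb_or => /andP[n10 b01] /andP[].
rewrite negb_or => /andP[n32 b23] r03.
have n20 : f (v 2) != f (v 0) by apply/eqP => e; rewrite e adjxx in r02.
have n30 : f (v 3) != f (v 0) by apply/eqP => e; rewrite e adjxx in r03.
have n21 : f (v 2) != f (v 1) by apply/eqP => e; rewrite e (negPf b01) in r02.
have n31 : f (v 3) != f (v 1) by apply/eqP => e; rewrite e (negPf b01) in r03.
have cases (i : 'I_4) : [\/ i = v 0, i = v 1, i = v 2 | i = v 3].
  by case: i => [[|[|[|[|i]]]] hi]; [constructor 1|constructor 2|constructor 3|
    constructor 4|by []]; apply/val_inj; rewrite /= inordK.
split.
- apply/injectiveP => i j; case: (cases i) => ->; case: (cases j) => -> // /eqP;
  by rewrite ?(negPf n10) ?(negPf n20) ?(negPf n30) ?(negPf n21) ?(negPf n31)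
    ?(negPf n32) // eq_sym
    ?(negPf n10) ?(negPf n20) ?(negPf n30) ?(negPf n21) ?(negPf n31) ?(negPf n32).
- apply/forallP => x; apply/forallP => y; apply/implyP; rewrite /adj /= => /set2P[]
    /eq_set2 [] [-> ->] //; rewrite -/(adj _ _ _) adjC //.
- apply/forallP => x; apply/forallP => y; apply/implyP; rewrite {1}/adj /= => /set2P[]
    /eq_set2 [] [-> ->] //; rewrite adjC //.
Qed.

Lemma card_embeddings_paw :
  #|embeddings coloured_paw G| =
  (\sum_x \sum_(y in N x) #|~: (x |: N x)| * #|N x :\: (y |: N y)|)%N.
Proof.
pose Q (q : (T * T) * (T * T)) :=
  [&& q.1.2 \in N q.1.1, q.2.1 \in ~: (q.1.1 |: N q.1.1) &
      q.2.2 \in N q.1.1 :\: (q.1.2 |: N q.1.2)].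
(* The images are grouped as ((0, 2), (1, 3)): once the edge that carries {0,2} is fixed, the images
   of 1 and 3 are chosen independently. *)
pose g (q : (T * T) * (T * T)) : {ffun 'I_4 -> T} :=
  [ffun i : 'I_4 => nth q.1.1 [:: q.1.1; q.2.1; q.1.2; q.2.2] i].
have g0 q : g q (v 0) = q.1.1 by rewrite ffunE inordK.
have g1 q : g q (v 1) = q.2.1 by rewrite ffunE inordK.
have g2 q : g q (v 2) = q.1.2 by rewrite ffunE inordK.
have g3 q : g q (v 3) = q.2.2 by rewrite ffunE inordK.
have ginj : injective g.
  move=> q q' e; rewrite (surjective_pairing q) (surjective_pairing q').
  rewrite (surjective_pairing q.1) (surjective_pairing q.2).
  by rewrite -g0 -g1 -g2 -g3 e g0 g1 g2 g3 -!surjective_pairing.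
have -> : embeddings coloured_paw G = g @: [set q | Q q].
  apply/setP => f; rewrite embeddings_pawP; apply/idP/imsetP.
    move=> h; exists ((f (v 0), f (v 2)), (f (v 1), f (v 3))); first by rewrite inE.
    apply/ffunP => -[[|[|[|[|i]]]] hi] //; rewrite ffunE /=; congr (f _);
    by apply/val_inj; rewrite /= inordK.
  by move=> [q]; rewrite inE => hq ->; rewrite g0 g1 g2 g3.
rewrite card_imset // -sum1_card.
rewrite pair_big_dep /=.
under [RHS]eq_bigr => p _ do rewrite -[#|~: _|]sum1_card -[#|_ :\: _|]sum1_card
  big_distrlr /= pair_big_dep /=.
rewrite pair_big_dep /=.
by apply: eq_big => // q; rewrite inE /Q.
Qed.

Lemma card_nonnbrs x : (#|~: (x |: N x)| + #|N x| + 1 = #|T|)%N.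
Proof.
have := cardsC (x |: N x); rewrite cardsU1 in_nbrs adjxx /=. lia.
Qed.

Lemma card_nbrsD x y : y \in N x ->
  (#|N x :\: (y |: N y)| + codeg G x y + 1 = #|N x|)%N.
Proof.
move=> xy; rewrite -(cardsID (y |: N y) (N x)) /codeg.
suff -> : N x :&: (y |: N y) = y |: (N x :&: N y).
  by rewrite cardsU1 !inE adjxx andbF; lia.
apply/setP => z; rewrite !inE; case: eqVneq => [->|] //=.
by rewrite -in_nbrs xy.
Qed.

(** Used twice: it yields the lower bound d(x) + d(y) - n for the codegree, and it bounds the number
    of vertices outside both neighbourhoods by the defect. *)
Lemma card_nbrsU x y : (#|~: (N x :|: N y)| + #|N x| + #|N y| = #|T| + codeg G x y)%N.
Proof.
by have := cardsC (N x :|: N y); have := cardsUI (N x) (N y); rewrite /codeg; lia.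
Qed.

End Counting.

(** * The sharp upper bound with its defect term *)

Definition max_bipartite (n : nat) : nat := (n./2 * uphalf n)%N.

Lemma max_bipartiteP n a b : (a + b = n)%N -> (a * b <= max_bipartite n)%N.
Proof.
move=> abn; rewrite /max_bipartite.
have hn : (n./2 + uphalf n = n)%N by lia.
have hk : (n./2 <= uphalf n <= n./2 + 1)%N by lia.
by have [ak|ak] := leqP a n./2; nia.
Qed.

Lemma max_bipartite_ge n : (n ^ 2 <= 4 * max_bipartite n + 1)%N.
Proof.
rewrite /max_bipartite.
have hn : (n./2 + uphalf n = n)%N by lia.
have hk : (n./2 <= uphalf n <= n./2 + 1)%N by lia.
by move: hk hn; move: (n./2) (uphalf n) => k l hk <-; rewrite expnS expn1; nia.
Qed.

Lemma max_bipartite_le n : (4 * max_bipartite n <= n ^ 2)%N.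
Proof.
rewrite /max_bipartite.
have e : (n./2 + uphalf n = n)%N by lia.
rewrite -[X in (_ <= X ^ 2)%N]e.
exact: (nat_AGM2 _ _).1.
Qed.

Section Bound.
Variable F : realFieldType.

(* Half the number of embeddings into the balanced complete bipartite graph. *)
Definition half_max_embeddings (n : nat) : F :=
  (max_bipartite n)%:R * ((max_bipartite n)%:R - n%:R + 1).
Local Notation X := half_max_embeddings.

(** With p = [max_bipartite n], 16X = 4p (4p - 4n + 4); insert 4p >= n^2 - 1 in both factors, the
    second becoming (n - 1)(n - 3). *)
Lemma half_max_embeddings_ge n : (4 <= n)%N ->
  ((n%:R ^+ 2 - 1) * (n%:R - 1) * (n%:R - 3) <= 16 * X n)%R.
Proof.
move=> n4.
have : (n ^ 2)%:R <= (4 * max_bipartite n + 1)%:R :> F.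
  by rewrite ler_nat max_bipartite_ge.
rewrite natrX natrD natrM /X => h.
have n4' : 4 <= n%:R :> F by rewrite (ler_nat F 4).
set m : F := n%:R in h n4' *; set p : F := (max_bipartite n)%:R in h *.
rewrite (_ : 16 * _ = (4 * p) * (4 * p - 4 * m + 4)); last ring.
rewrite -mulrA; apply: ler_pM; last 2 first.
- by lra.
- by lra.
- by have : 0 <= (m - 1) * (m + 1) by [apply: mulr_ge0; lra]; lra.
- by apply: mulr_ge0; lra.
Qed.

Lemma edge_ineq n a b t : (80 <= n)%N -> (0 < a < n)%N -> (0 < b < n)%N ->
  (a + b <= n + t)%N -> (t <= n)%N ->
  (n%:R - 1 - a%:R) * (a%:R - 1 - t%:R) + (n%:R - 1 - b%:R) * (b%:R - 1 - t%:R)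
    + n%:R / 40 * (`|a%:R + b%:R - n%:R| + t%:R)
  <= 2 * X n / n%:R * (a%:R^-1 + b%:R^-1).
Proof.
move=> n80 /andP[a0 an] /andP[b0 bn] abt tn.
have hn : 80 <= n%:R :> F by rewrite (ler_nat F 80).
have ha : 1 <= a%:R :> F by rewrite (ler_nat F 1).
have hb : 1 <= b%:R :> F by rewrite (ler_nat F 1).
have han : a%:R <= n%:R - 1 :> F by rewrite lerBrDr natr1 ler_nat.
have hbn : b%:R <= n%:R - 1 :> F by rewrite lerBrDr natr1 ler_nat.
have ht : t%:R <= n%:R :> F by rewrite ler_nat.
have habt : a%:R + b%:R <= n%:R + t%:R :> F by rewrite -!natrD ler_nat.
have hX : (n%:R ^+ 2 - 1) * (n%:R - 1) * (n%:R - 3) <= 16 * X n.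
  by apply: half_max_embeddings_ge; lia.
have [s|s|s] := ltngtP (a + b)%N n.
- apply: edge_ineq_lt => //; first lra.
  by rewrite lerBrDr -natrD natr1 ler_nat.
- apply: edge_ineq_gt => //; last lra.
  by rewrite natr1 -natrD ler_nat.
- rewrite /X; apply: edge_ineq_eq => //; first lra.
  + by rewrite -natrD s.
  + by rewrite -natrM ler_nat max_bipartiteP.
Qed.

Variables (T : finType) (G : graph T).
Local Notation N := (nbrs G).
Local Notation n := #|T|.
Local Notation deg x := (#|N x|%:R : F).
Local Notation codegR x y := ((codeg G x y)%:R : F).

Lemma sum_edgesC (f : T -> T -> F) :
  \sum_x \sum_(y in N x) f x y = \sum_x \sum_(y in N x) f y x.
Proof.
rewrite (exchange_big_dep predT) //=; apply: eq_bigr => x _.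
by apply: eq_bigl => y; rewrite nbrsC.
Qed.

Lemma embeddings_pawE : #|embeddings coloured_paw G|%:R =
  \sum_x \sum_(y in N x) (n%:R - 1 - deg x) * (deg x - 1 - codegR x y).
Proof.
rewrite card_embeddings_paw natr_sum; apply: eq_bigr => x _.
rewrite natr_sum; apply: eq_bigr => y xy; rewrite natrM.
rewrite -(card_nonnbrs G x) -(card_nbrsD xy) !natrD; ring.
Qed.

Lemma nbrs_gt0 x y : y \in N x -> (0 < #|N x| < n)%N.
Proof.
move=> xy; apply/andP; split; first by apply/card_gt0P; exists y.
by have := card_nonnbrs G x; lia.
Qed.

Lemma codeg_le x y : (codeg G x y <= n)%N.
Proof. exact: max_card. Qed.

Definition defect x y : F := `|deg x + deg y - n%:R| + codegR x y.

Lemma defect_ge0 x y : 0 <= defect x y.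
Proof. by rewrite addr_ge0. Qed.

(** Adding the two orientations of every edge counts the embeddings twice, so the n/40 of
    [edge_ineq] becomes n/80 here. *)
Lemma embeddings_paw_defect : (80 <= n)%N ->
  #|embeddings coloured_paw G|%:R
    + n%:R / 80 * (\sum_x \sum_(y in N x) defect x y) <= 2 * X n.
Proof.
move=> n80; rewrite embeddings_pawE.
pose h x y := (n%:R - 1 - deg x) * (deg x - 1 - codegR x y).
rewrite -/(h _ _).
have n0 : 0 < n%:R :> F by rewrite ltr0n; lia.
have X0 : 0 <= X n.
  (* The split of n into n - 1 and 1 gives [max_bipartite n] >= n - 1, hence X >= 0. *)
  have e : (n - 1 + 1 = n)%N by lia.
  have := max_bipartiteP e; rewrite muln1 => {}e.
  by rewrite mulr_ge0 // addrAC subr_ge0 natr1 ler_nat; lia.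
have key : \sum_x \sum_(y in N x) (h x y + h y x + n%:R / 40 * defect x y) <=
    \sum_x \sum_(y in N x) (2 * X n / n%:R * ((deg x)^-1 + (deg y)^-1)).
  apply: ler_sum => x _; apply: ler_sum => y xy.
  have yx : x \in N y by rewrite nbrsC.
  rewrite /h /defect (codegC G y x); apply: edge_ineq => //.
  - exact: nbrs_gt0 xy.
  - exact: nbrs_gt0 yx.
  - by have := card_nbrsU G x y; lia.
  - exact: codeg_le.
have L : \sum_x \sum_(y in N x) (h x y + h y x + n%:R / 40 * defect x y) =
   2 * (\sum_x \sum_(y in N x) h x y)
    + n%:R / 40 * \sum_x \sum_(y in N x) defect x y.
  rewrite [2 * _]mulr_natl mulr2n {2}(sum_edgesC h) mulr_sumr -!big_split.
  by apply: eq_bigr => x _; rewrite mulr_sumr -!big_split.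
have U : \sum_x \sum_(y in N x) (2 * X n / n%:R * ((deg x)^-1 + (deg y)^-1)) <=
    4 * X n.
  under eq_bigr do rewrite -mulr_sumr big_split /=.
  rewrite -mulr_sumr big_split /= -(sum_edgesC (fun x y => (deg x)^-1)).
  (* A vertex contributes d(x) / d(x) = 1, or an empty sum if it is isolated. *)
  have S1 : \sum_x \sum_(y in N x) (deg x)^-1 <= n%:R.
    apply: (@le_trans _ _ (\sum_(x : T) 1)); last by rewrite sumr_const.
    apply: ler_sum => x _; rewrite sumr_const -[_^-1 *+ _]mulr_natr.
    have [->|d0] := eqVneq (deg x) 0; first by rewrite mulr0.
    by rewrite mulVf.
  apply: (@le_trans _ _ (2 * X n / n%:R * (n%:R + n%:R))).
    by apply: ler_wpM2l; [apply: divr_ge0; [exact: mulr_ge0 | exact: ltW] | exact: lerD].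
  rewrite le_eqVlt; apply/orP; left; apply/eqP; field; exact: lt0r_neq0.
have := le_trans key U; rewrite L; lra.
Qed.
End Bound.

(** * Embeddings into complete bipartite graphs *)

Lemma adj_complete (W : finType) (i j : W) : adj (complete W) i j = (i != j).
Proof. by rewrite /adj inE cards2; case: (i != j). Qed.

Section Bipartite.
Variables (F : realFieldType) (n : nat) (p : 'I_n -> 'I_2).
Local Notation K := (blowup (complete 'I_2) p).

Lemma in_nbrs_bipartite x y : (y \in nbrs K x) = (p y != p x).
Proof. by rewrite in_nbrs adj_blowup adj_complete eq_sym. Qed.

Lemma card_nbrs_bipartite x : (fibre_size p (p x) + #|nbrs K x| = n)%N.
Proof.
rewrite -[RHS]card_ord -(cardC [pred y | p y == p x]); congr addn.
by apply: eq_card => y; rewrite in_nbrs_bipartite !inE.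
Qed.

Lemma codeg_bipartite x y : y \in nbrs K x -> codeg K x y = 0%N.
Proof.
rewrite in_nbrs_bipartite => xy; apply/eqP; rewrite cards_eq0; apply/eqP.
apply/setP => z; rewrite finset.in_setI finset.in_set0 !in_nbrs_bipartite.
by move: (p x) (p y) (p z) xy => [[|[|?]] ?] [[|[|?]] ?] [[|[|?]] ?].
Qed.

Lemma sum_fibres (f : 'I_2 -> F) :
  \sum_x f (p x) = \sum_i f i *+ fibre_size p i.
Proof.
rewrite (partition_big p predT) //=; apply: eq_bigr => i _.
by rewrite -sumr_const; apply: eq_bigr => x /eqP ->.
Qed.

Lemma embeddings_paw_bipartite :
  fibre_size p ord0 = n./2 ->
  #|embeddings coloured_paw K|%:R = 2 * half_max_embeddings F n.
Proof.
move=> p0; pose s (i : 'I_2) : F := (fibre_size p i)%:R.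
rewrite (embeddings_pawE F) card_ord.
(* A vertex in a part of size s has n - s neighbours, and each such edge extends in (s - 1)(n - s -
   1) ways. Parts of sizes k and l give 2kl(k - 1)(l - 1) in all, and (k - 1)(l - 1) = kl - n +
   1. *)
pose f i := (n%:R - s i) * (s i - 1) * (n%:R - s i - 1).
transitivity (\sum_x f (p x)).
  apply: eq_bigr => x _.
  have dx : #|nbrs K x|%:R = n%:R - s (p x).
    have : (fibre_size p (p x) + #|nbrs K x|)%:R = n%:R :> F.
      by rewrite card_nbrs_bipartite.
    by rewrite natrD => <-; rewrite /s addrAC subrr add0r.
  under eq_bigr => y xy do rewrite codeg_bipartite // dx.
  by rewrite sumr_const -[_ *+ _]mulr_natr dx /f; ring.
rewrite sum_fibres big_ord_recl big_ord1 /f.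
have -> : lift ord0 ord0 = ord_max :> 'I_2 by apply/val_inj.
have e : (fibre_size p ord0 + fibre_size p ord_max = n)%N.
  rewrite -[RHS]card_ord -(cardC [pred y | p y == ord0]); congr addn.
  apply: eq_card => y; rewrite !inE.
  by case: (p y) => [[|[|?]] ?].
have p1 : fibre_size p ord_max = uphalf n by lia.
have en : n%:R = (n./2)%:R + (uphalf n)%:R :> F by rewrite -natrD; congr _%:R; lia.
rewrite -[X in X + _]mulr_natr -[X in _ + X]mulr_natr /s p0 p1 /half_max_embeddings.
rewrite /max_bipartite natrM en; ring.
Qed.
End Bipartite.

(** * The limit of the maximum density and the optimal weights *)

Section MaxDensity.
Variable R : realType.

Lemma max_densityE n : (80 <= n)%N ->
  max_density R coloured_paw n = 2 * half_max_embeddings R n / (n ^_ 4)%:R.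
Proof.
move=> n80.
have f0 : 0 < (n ^_ 4)%:R :> R by rewrite ltr0n ffact_gt0; lia.
have n0 : 0 < n%:R :> R by rewrite ltr0n; lia.
have ub (G : graph 'I_n) :
    density R coloured_paw G <= 2 * half_max_embeddings R n / (n ^_ 4)%:R.
  rewrite /density !card_ord ler_pM2r ?invr_gt0 //.
  have := @embeddings_paw_defect R _ G; rewrite card_ord => /(_ n80).
  apply: le_trans; rewrite lerDl; apply: mulr_ge0; first exact: divr_ge0.
  by apply: sumr_ge0 => x _; apply: sumr_ge0 => y _; exact: defect_ge0.
have hs : (\sum_(i < 2) (if i == ord0 then n./2 else uphalf n) = n)%N.
  by rewrite big_ord_recl big_ord1 /=; lia.
have [p /(_ ord0) /= hp] := ex_map_fibre_size hs.
have at_p : density R coloured_paw (blowup (complete 'I_2) p) =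
    2 * half_max_embeddings R n / (n ^_ 4)%:R.
  by rewrite /density embeddings_paw_bipartite // !card_ord.
apply/eqP; rewrite eq_le; apply/andP; split.
  (* The maximum starts from 0, so the bound itself must be nonnegative; it is, being a density. *)
  apply: bigmax_le => [|G _]; last exact: ub.
  by rewrite -at_p divr_ge0.
by rewrite -at_p; exact: le_bigmax.
Qed.

Lemma cvg_half_max_embeddings :
  ((half_max_embeddings R n / n%:R ^+ 4)%R @[n --> \oo] --> (1 / 16 : R)%R)%classic.
Proof.
have hV := @cvg_invn R.
have hlow : (((1 - n%:R^-1 ^+ 2) * (1 - n%:R^-1) * (1 - 3 * n%:R^-1) / 16)%R
   @[n --> \oo] --> ((1 - 0 ^+ 2) * (1 - 0) * (1 - 3 * 0) / 16 : R)%R)%classic.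
  apply: cvgM; last exact: cvg_cst.
  apply: cvgM; last by apply: cvgB; [exact: cvg_cst|apply: cvgM hV; exact: cvg_cst].
  apply: cvgM; last by apply: cvgB hV; exact: cvg_cst.
  by apply: cvgB; [exact: cvg_cst|exact: (cvgM hV hV)].
rewrite expr0n /= mulr0 !subr0 !mulr1 in hlow.
apply: squeeze_cvgr hlow (cvg_cst _); near=> n.
have n4 : (4 <= n)%N by near: n; exact: nbhs_infty_ge.
have n4' : 4 <= n%:R :> R by rewrite (ler_nat R 4).
have lo := half_max_embeddings_ge R n4.
have up : (4 * max_bipartite n)%:R <= (n ^ 2)%:R :> R.
  by rewrite ler_nat max_bipartite_le.
have n0 : 0 < n%:R ^+ 4 :> R by rewrite exprn_gt0; lra.
rewrite ler_pdivlMr // ler_pdivrMr //; apply/andP; split.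
  rewrite (_ : _ * n%:R ^+ 4 =
    (n%:R ^+ 2 - 1) * (n%:R - 1) * (n%:R - 3) / 16).
    by rewrite ler_pdivrMr // [_ * 16]mulrC.
  by field; apply/lt0r_neq0; lra.
rewrite natrM natrX in up; rewrite /half_max_embeddings.
have P0 : 0 <= (max_bipartite n)%:R :> R by [].
set P : R := (max_bipartite n)%:R in up P0 *; set m : R := n%:R in n4' n0 up *.
(* Together these give P (P - m + 1) <= P^2 <= m^4 / 16. *)
have h1 : 0 <= P * (m - 1) by apply: mulr_ge0; lra.
have h2 : 0 <= (m ^+ 2 - 4 * P) * (m ^+ 2 + 4 * P).
  by apply: mulr_ge0; [lra|rewrite addr_ge0 ?mulr_ge0 ?sqr_ge0].
by lra.
Unshelve. all: by end_near. Qed.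

Lemma cvg_max_density :
  (max_density R coloured_paw n @[n --> \oo] --> (1 / 8 : R)%R)%classic.
Proof.
have h1 : ((2 * (half_max_embeddings R n / n%:R ^+ 4) *
     ((n ^_ 4)%:R / n%:R ^+ 4)^-1)%R @[n --> \oo]
     --> (2 * (1 / 16) * 1^-1 : R)%R)%classic.
  apply: cvgM; first by apply: cvgM cvg_half_max_embeddings; exact: cvg_cst.
  by apply: cvgV; [exact: oner_neq0|exact: cvg_ffact_ratio].
rewrite (_ : 2 * (1 / 16) * 1^-1 = 1 / 8) in h1; last by field.
apply: cvg_trans h1; apply: near_eq_cvg; near=> n.
have n80 : (80 <= n)%N by near: n; exact: nbhs_infty_ge.
rewrite max_densityE //; field.
by rewrite !pnatr_eq0 -!lt0n ffact_gt0; apply/andP; split; lia.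
Unshelve. all: by end_near. Qed.

Local Notation v i := (inord i : 'I_4).

(** In K_2 a blue edge forces equal images and a red edge distinct ones. So 0 and 1 go to one vertex
    i, 2 and 3 to the other, and there is one map for each i. *)
Lemma blowup_poly_paw (a : 'rV[R]_2) :
  blowup_poly coloured_paw (complete 'I_2) a =
  2 * (a 0 ord0 * a 0 ord_max) ^+ 2.
Proof.
pose g (i : 'I_2) : {ffun 'I_4 -> 'I_2} :=
  [ffun k : 'I_4 => if (k < 2)%N then i else rev_ord i].
have gE i : \prod_x a 0 (g i x) = (a 0 ord0 * a 0 ord_max) ^+ 2.
  rewrite !big_ord_recl big_ord0 !ffunE /=.
  have [->|->] : i = ord0 \/ i = ord_max.
    by case: i => [[|[|?]] hi]; [left|right|by []]; apply/val_inj.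
  - have -> : rev_ord ord0 = ord_max :> 'I_2 by apply/val_inj.
    ring.
  - have -> : rev_ord ord_max = ord0 :> 'I_2 by apply/val_inj.
    ring.
have ginj : injective g.
  by move=> i j /ffunP /(_ ord0); rewrite !ffunE.
rewrite /blowup_poly.
have -> : blowup_maps coloured_paw (complete 'I_2) = [set g i | i in 'I_2].
  apply/setP => f; apply/idP/imsetP.
    rewrite inE => /andP[/forallP hr /forallP hb].
    have r02 := implyP (forallP (hr (v 0)) (v 2)).
    have r03 := implyP (forallP (hr (v 0)) (v 3)).
    have b01 := implyP (forallP (hb (v 0)) (v 1)).
    have b23 := implyP (forallP (hb (v 2)) (v 3)).
    rewrite !adj_complete in r02 r03 b01 b23.
    have [e02 e03 e01 e23] := coloured_paw_edges.
    move: {r02 r03 b01 b23} (r02 e02) (r03 e03) (b01 e01) (b23 e23) => r02 r03 b01 b23.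
    rewrite !negbK in b01 b23.
    exists (f (v 0)) => //; apply/ffunP => k; rewrite ffunE.
    have rev (i j : 'I_2) : i != j -> j = rev_ord i.
      by move: i j => [[|[|?]] hi] [[|[|?]] hj] //= _; apply/val_inj.
    case: k => [[|[|[|[|k]]]] hk] //=.
    - by congr (f _); apply/val_inj; rewrite /= inordK.
    - by rewrite (eqP b01); congr (f _); apply/val_inj; rewrite /= inordK.
    - by rewrite -(rev _ _ r02); congr (f _); apply/val_inj; rewrite /= inordK.
    - by rewrite -(rev _ _ r03); congr (f _); apply/val_inj; rewrite /= inordK.
  move=> [i _ ->]; rewrite inE; apply/andP; split;
    apply/forallP => x; apply/forallP => y; apply/implyP;
    rewrite {1}/adj /= => /set2P[] /eq_set2 [] [-> ->];
    rewrite adj_complete !ffunE !inordK //=;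
    by case: (i) => [[|[|?]] hi].
rewrite big_imset /=; last by move=> i j _ _; exact: ginj.
rewrite (eq_bigr (fun=> (a 0 ord0 * a 0 ord_max) ^+ 2)); last by move=> i _; exact: gE.
by rewrite sumr_const card_ord mulr_natl.
Qed.

Lemma maximizers_paw :
  maximizers (blowup_density coloured_paw (complete 'I_2)) (simplex R 2)
    = [set const_mx (1 / 2)]%classic.
Proof.
have simplexE (a : 'rV[R]_2) : simplex R 2 a <->
    [/\ 0 <= a 0 ord0, 0 <= a 0 ord_max & a 0 ord0 + a 0 ord_max = 1].
  have lE : lift ord0 ord0 = ord_max :> 'I_2 by apply/val_inj.
  rewrite /simplex /= big_ord_recl big_ord1 lE; split=> [[h ?]|[h0 h1 ?]]; first by [].
  split=> // i; have [->|->] // : i = ord0 \/ i = ord_max.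
  by case: i => [[|[|?]] hi]; [left|right|by []]; apply/val_inj.
have half : simplex R 2 (const_mx (1 / 2)).
  by apply/simplexE; rewrite !mxE; split; lra.
apply/seteqP; split=> [a [sa amax]|_ ->].
  have := amax _ half; rewrite !blowup_densityE // !blowup_poly_paw !mxE.
  have [a0 a1 a2] := (simplexE a).1 sa.
  set x := a 0 ord0 in a0 a2 *; set y := a 0 ord_max in a1 a2 *.
  move=> h.
  have xy0 : 0 <= x * y by exact: mulr_ge0.
  (* [h] compares [a] with (1/2, 1/2) and reads 2 (1/4)^2 <= 2 (xy)^2. As x + y = 1, the bound xy >=
     1/4 says that (x - 1/2)^2 <= 0. *)
  have xy : 1 / 4 <= x * y.
    rewrite leNgt; apply/negP => lt.
    have : 0 < (1 / 4 - x * y) * (1 / 4 + x * y) by apply: mulr_gt0; lra.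
    lra.
  have xE : x = 1 / 2.
    have sq : (x - 1 / 2) ^+ 2 <= 0.
      have yE : y = 1 - x by lra.
      by rewrite yE in xy; lra.
    apply/eqP; rewrite -subr_eq0 -sqrf_eq0 eq_le sq; exact: sqr_ge0.
  rewrite /=; apply/rowP => i; rewrite mxE.
  have [->|->] : i = ord0 \/ i = ord_max.
    by case: i => [[|[|?]] hi]; [left|right|by []]; apply/val_inj.
  - exact: xE.
  - by rewrite -/y; lra.
split=> // b sb; rewrite !blowup_densityE // !blowup_poly_paw !mxE.
have [b0 b1 b2] := (simplexE b).1 sb.
rewrite ler_wpM2l // ler_pXn2r ?nnegrE ?mulr_ge0 //; try lra.
have -> : b 0 ord_max = 1 - b 0 ord0 by lra.
by have := sqr_ge0 (b 0 ord0 - 1 / 2); lra.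
Qed.
End MaxDensity.

(** * Distance to the bipartition given by a neighbourhood *)

Section EditDistance.
Variables (T : finType) (G : graph T).
Local Notation N := (nbrs G).

Definition disagreements (G' : graph T) : {set T * T} :=
  [set q | adj G q.1 q.2 != adj G' q.1 q.2].

(** The identity permutation suffices: every edge of the symmetric difference comes from an ordered
    pair of disagreement. *)
Lemma edit_distance_le G' : (edit_distance G G' <= #|disagreements G'|)%N.
Proof.
have le1 : (edit_distance G G' <= edit_cost G G' 1%g)%N.
  rewrite /edit_distance; elim/big_rec: _ => // s m _ h.
  by rewrite geq_min h orbT.
apply: leq_trans le1 _.
rewrite /edit_cost.
have -> : [set (1%g : {perm T}) @: (e : {set T}) | e in edges G] = edges G.
  rewrite -[RHS]imset_id; apply: eq_imset => e.
  by rewrite -[RHS]imset_id; apply: eq_imset => x; rewrite perm1.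
apply: leq_trans (leq_imset_card (fun q : T * T => [set q.1; q.2]) _).
apply/subset_leq_card/fintype.subsetP => e he.
have e2 : #|e| == 2%N.
  move: he; rewrite !inE => /orP[] /andP[_].
    exact: (forall_inP (edgesP G)).
  exact: (forall_inP (edgesP G')).
have [x [y [_ exy]]] := cards2P _ e2.
suff xy : (x, y) \in disagreements G' by apply/imsetP; exists (x, y).
rewrite inE /adj /= -exy.
by move: he; rewrite !inE; case: (e \in edges G); case: (e \in edges G').
Qed.

Definition nbr_blowup (y : T) : graph T :=
  blowup (complete 'I_2) (fun u => if u \in N y then ord_max else ord0).

Lemma sum_pairs (A : {set T}) (B : T -> {set T}) :
  (\sum_u \sum_v ((u \in A) && (v \in B u) : nat) = \sum_(u in A) #|B u|)%N.
Proof.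
rewrite [RHS]big_mkcond; apply: eq_bigr => u _.
case: (u \in A) => /=; last by rewrite big1.
by rewrite -sum1_card [RHS]big_mkcond; apply: eq_bigr => v _; case: (v \in B u).
Qed.

(** Adjacent u, v inside N(y) are counted by the codegree of u and y; non-adjacent u in N(y) and v
    outside, by v lying outside N(u) and N(y). For adjacent u, v both outside N(y), either both lie
    in N(x), which the codegree of u and x counts, or one of them lies outside N(x) and N(y). *)
Lemma card_disagreements_nbr_blowup (x y : T) :
  (#|disagreements (nbr_blowup y)| <=
     \sum_(u in N y) (codeg G u y + 2 * #|~: (N u :|: N y)|)
     + \sum_(u in N x) codeg G u x + 2 * (#|~: (N x :|: N y)| * #|T|))%N.
Proof.
pose far := ~: (N x :|: N y).
have -> : #|disagreements (nbr_blowup y)| = (\sum_u \sum_v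
    ((u, v) \in disagreements (nbr_blowup y) : nat))%N.
  rewrite pair_big /= -sum1_card big_mkcond; apply: eq_bigr => -[u v] _ /=.
  by case: (_ \in _).
rewrite big_split /= -big_distrr /= -!sum_pairs.
have far_sum : (#|far| * #|T| = \sum_u \sum_v ((u \in far) && (v \in [set: T]) : nat))%N.
  by rewrite sum_pairs sum_nat_const cardsT.
(* The doubled sums absorb the two orders of an asymmetric pair; once they are symmetrised, the
   inequality holds for each (u, v) separately. *)
have twice (f : T -> T -> nat) :
    (2 * (\sum_u \sum_v f u v) = \sum_u \sum_v (f u v + f v u))%N.
  rewrite mul2n -addnn {2}exchange_big /= -big_split /=.
  by apply: eq_bigr => u _; rewrite -big_split.
rewrite -/far far_sum !twice -!big_split /=; apply: leq_sum => u _.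
rewrite -!big_split /=; apply: leq_sum => v _.
rewrite !inE adj_blowup adj_complete !in_nbrs.
rewrite /= [adj G v u]adjC.
by case: (adj G y u); case: (adj G y v); case: (adj G x u); case: (adj G x v);
  case: (adj G u v).
Qed.
End EditDistance.

(** * Averaging over edges *)

Section Averaging.
Variables (F : realFieldType) (T : finType) (G : graph T).
Local Notation N := (nbrs G).
Local Notation n := #|T|.
Local Notation total_defect := (\sum_x \sum_(y in N x) defect F G x y).
Local Notation degree_sum := (\sum_x #|N x|)%N.

Lemma defectC x y : defect F G x y = defect F G y x.
Proof. by rewrite /defect codegC [X in `|X - _|]addrC. Qed.

Lemma codeg_defect x y : (codeg G x y)%:R <= defect F G x y.
Proof. by rewrite lerDr. Qed.

Lemma card_nbrsU_defect x y : #|~: (N x :|: N y)|%:R <= defect F G x y.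
Proof.
have /(congr1 (fun k => k%:R : F)) := card_nbrsU G x y.
rewrite !natrD /defect => h.
have := ler_norm (- (#|N x|%:R + #|N y|%:R - n%:R : F)).
rewrite normrN; lra.
Qed.

(** The bound of [card_disagreements_nbr_blowup] with every count replaced by a defect; 3 is one
    codegree plus twice the vertices outside both neighbourhoods. *)
Definition disagreement_bound x y : F :=
  3 * (\sum_(u in N y) defect F G u y) + \sum_(u in N x) defect F G u x
    + 2 * n%:R * defect F G x y.

Lemma disagreements_le x y :
  #|disagreements G (nbr_blowup G y)|%:R <= disagreement_bound x y.
Proof.
have := card_disagreements_nbr_blowup G x y.
rewrite -(ler_nat F) => /le_trans; apply.
rewrite !natrD !natrM !natr_sum /disagreement_bound.
apply: lerD; first apply: lerD.
- rewrite mulr_sumr; apply: ler_sum => u _; rewrite natrD natrM.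
  by have := codeg_defect u y; have := card_nbrsU_defect u y; lra.
- by apply: ler_sum => u _; exact: codeg_defect.
- have h : 0 <= n%:R * (defect F G x y - #|~: (N x :|: N y)|%:R).
    by rewrite mulr_ge0 // subr_ge0 card_nbrsU_defect.
  by lra.
Qed.

(** Summed over edges, the defect at one endpoint is repeated as often as its degree, at most n
    times; hence 6 = 3 + 1 + 2. *)
Lemma sum_disagreement_bound :
  \sum_x \sum_(y in N x) disagreement_bound x y <= 6 * n%:R * total_defect.
Proof.
pose s y := \sum_(u in N y) defect F G u y.
have s0 y : 0 <= s y by apply: sumr_ge0 => u _; exact: defect_ge0.
have S1 : \sum_x \sum_(y in N x) s x <= n%:R * total_defect.
  rewrite mulr_sumr; apply: ler_sum => x _; rewrite sumr_const -[_ *+ _]mulr_natl.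
  have -> : \sum_(y in N x) defect F G x y = s x.
    by apply: eq_bigr => y _; exact: defectC.
  by rewrite ler_wpM2r // ler_nat max_card.
have -> : \sum_x \sum_(y in N x) disagreement_bound x y =
    3 * (\sum_x \sum_(y in N x) s y) + \sum_x \sum_(y in N x) s x
      + 2 * n%:R * total_defect.
  rewrite !mulr_sumr -!big_split; apply: eq_bigr => x _.
  by rewrite !mulr_sumr -!big_split.
rewrite (sum_edgesC _ (fun x y => s y)) /=.
by lra.
Qed.

(** An edge minimising Q is at most the average, [degree_sum] being the number of ordered edges. *)
Lemma edge_below_average (Q : T -> T -> F) (S : F) :
  (0 < degree_sum)%N -> \sum_x \sum_(y in N x) Q x y <= S ->
  exists x y, Q x y * degree_sum%:R <= S.
Proof.
move=> E0 QS.
have [x0 [y0 xy0]] : exists x0 y0, y0 \in N x0.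
  move: E0; rewrite lt0n sum_nat_eq0 negb_forall => /existsP[x0 /=].
  by rewrite -lt0n => /card_gt0P[y0 ?]; exists x0, y0.
pose P (q : T * T) := q.2 \in N q.1.
have Pxy0 : P (x0, y0) by [].
case: (@arg_minP _ _ _ (x0, y0) P (fun q => Q q.1 q.2) Pxy0) => -[x y] _ min.
exists x, y; apply: le_trans QS.
rewrite natr_sum mulr_sumr; apply: ler_sum => u _.
rewrite mulr_natr -sumr_const; apply: ler_sum => w uw.
exact: (min (u, w)).
Qed.

Lemma exists_close_nbr_blowup : (0 < degree_sum)%N ->
  exists y, #|disagreements G (nbr_blowup G y)|%:R * degree_sum%:R
    <= 6 * n%:R * total_defect.
Proof.
move=> E0; have [x [y h]] := edge_below_average E0 sum_disagreement_bound.
exists y; apply: le_trans h; rewrite ler_wpM2r //; exact: disagreements_le.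
Qed.

(** Serves the sparse case of stability: a graph with few edges has few embeddings. *)
Lemma embeddings_paw_degree_sum :
  (#|embeddings coloured_paw G| <= degree_sum * n ^ 2)%N.
Proof.
rewrite card_embeddings_paw big_distrl; apply: leq_sum => x _ /=.
rewrite -sum_nat_const; apply: leq_sum => y _.
by rewrite expnS expn1 leq_mul // max_card.
Qed.
End Averaging.

(** * Perfect stability *)

Section Stability.
Variable R : realType.

Lemma half_max_embeddings_ge_pow4 n : (80 <= n)%N ->
  n%:R ^+ 4 <= 20 * half_max_embeddings R n.
Proof.
move=> n80; have h := half_max_embeddings_ge R (leq_trans _ n80).
have n80' : 80 <= n%:R :> R by rewrite (ler_nat R 80).
have {h} := h isT; set m : R := n%:R in n80' * => h.
have h3 : 0 <= m ^+ 3 * (m - 80) by apply: mulr_ge0; [exact: exprn_ge0; lra | lra].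
have h2 : 0 <= m ^+ 2 by exact: sqr_ge0.
have h4 : 0 <= m ^+ 3 by apply: exprn_ge0; lra.
by lra.
Qed.

(* The factor 80 comes from embeddings_paw_defect, and 96 = 6 * 16 from averaging
   sum_disagreement_bound over at least n^2 / 16 ordered edges. *)
Lemma edit_distance_embeddings n (G : graph 'I_n) : (80 <= n)%N ->
  exists p : 'I_n -> 'I_2,
    (edit_distance G (blowup (complete 'I_2) p))%:R * n%:R ^+ 2
      <= (96 * 80) * (2 * half_max_embeddings R n - #|embeddings coloured_paw G|%:R).
Proof.
move=> n80.
set X := half_max_embeddings R n; set L : R := #|_|%:R.
set E := (\sum_x #|nbrs G x|)%N.
have n80' : 80 <= n%:R :> R by rewrite (ler_nat R 80).
have bound := @embeddings_paw_defect R _ G.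
rewrite card_ord in bound; have {}bound := bound n80.
have [small|large] := ltnP (16 * E) (n ^ 2).
  (* With fewer than n^2 / 16 ordered edges there are at most n^4 / 16 embeddings, against 2X >= n^4
     / 10. The deficit is then of order n^4 and even the empty graph, with one part void, is close
     enough. *)
  exists (fun=> ord0).
  have e1 : (edit_distance G (blowup (complete 'I_2) (fun=> ord0)))%:R <= n%:R ^+ 2 :> R.
    rewrite -natrX ler_nat; apply: leq_trans (edit_distance_le _ _) _.
    by rewrite (leq_trans (max_card _)) // card_prod card_ord expnS expn1.
  have e2 : 16 * L <= n%:R ^+ 4.
    rewrite -natrX -natrM ler_nat.
    apply: (@leq_trans (16 * (E * n ^ 2))).
      by rewrite leq_mul2l; have := embeddings_paw_degree_sum G; rewrite card_ord.
    by rewrite mulnA (expnD n 2 2) leq_mul2r ltnW ?orbT.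
  have := half_max_embeddings_ge_pow4 n80; rewrite -/X => e3.
  have e4 : (edit_distance G (blowup (complete 'I_2) (fun=> ord0)))%:R * n%:R ^+ 2
      <= n%:R ^+ 4 :> R.
    rewrite (_ : n%:R ^+ 4 = n%:R ^+ 2 * n%:R ^+ 2); last by rewrite -exprD.
    by rewrite ler_wpM2r // sqr_ge0.
  have e5 : 0 <= n%:R ^+ 4 :> R by rewrite exprn_ge0.
  move: e2 e3 e4 e5; move: (_%:R * _ ^+ 2) (_ ^+ 4) L X => ed q L X; lra.
have E0 : (0 < E)%N.
  rewrite lt0n; apply/eqP => e; move: large; rewrite e muln0 leqn0 expn_eq0; lia.
have [y hy] := exists_close_nbr_blowup R E0.
rewrite card_ord in hy.
eexists; apply: le_trans (_ : #|disagreements G (nbr_blowup G y)|%:R * n%:R ^+ 2 <= _).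
  by rewrite ler_wpM2r ?sqr_ge0 // ler_nat; exact: edit_distance_le.
set B : R := #|_|%:R in hy *; set D : R := \sum_x _ in bound hy.
have large' : n%:R ^+ 2 <= 16 * E%:R :> R by rewrite -natrX -natrM ler_nat.
(* The chain is B n^2 <= 16 B E <= 96 n D, and n D / 80 is at most the deficit. *)
apply: (@le_trans _ _ (B * (16 * E%:R))); first by rewrite ler_wpM2l.
rewrite -/L -/X in bound.
have : n%:R / 80 * D * (96 * 80) <= (96 * 80) * (2 * X - L) by lra.
by rewrite -/E in hy; lra.
Qed.

Lemma paw_perfectly_stable : perfectly_stable R coloured_paw (complete 'I_2).
Proof.
(* The same constant serves as the threshold on n, since it exceeds 80. *)
exists (96 * 80); split=> [||n G nC]; first lra; first by rewrite card_ord; lra.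
have n80 : (80 <= n)%N.
  by rewrite -(ler_nat R); apply: le_trans nC; lra.
have [p hp] := edit_distance_embeddings G n80; exists p.
rewrite max_densityE // /density !card_ord -mulrBl.
have n0 : 0 < n%:R :> R by rewrite ltr0n; lia.
have n2 : 0 < n%:R ^+ 2 :> R by rewrite exprn_gt0.
have f0 : 0 < (n ^_ 4)%:R :> R by rewrite ltr0n ffact_gt0; lia.
set d := _ - _ in hp *.
have d0 : 0 <= d.
  rewrite -(pmulr_rge0 _ (_ : 0 < (96 * 80))) //; apply: le_trans hp.
  by rewrite mulr_ge0.
rewrite -(ler_pM2r n2); apply: le_trans hp _.
(* The falling factorial is at most n^4, so passing from embeddings to densities leaves the constant
   unchanged. *)
have e : d <= d / (n ^_ 4)%:R * (n%:R ^+ 2 * n%:R ^+ 2).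
  rewrite mulrAC ler_pdivlMr // ler_wpM2l // -exprD -natrX ler_nat.
  by rewrite !ffactnS ffactn0 !expnS expn0 !leq_mul //; lia.
by move: e; move: (n%:R ^+ 2) (_ / _) => q r; lra.
Qed.
End Stability.

Theorem theorem3p12 (R : realType) :
  [/\ (max_density R coloured_paw n @[n --> \oo] --> (1 / 8 : R)%R)%classic,
      perfectly_stable R coloured_paw (complete 'I_2) &
      maximizers (blowup_density coloured_paw (complete 'I_2)) (simplex R 2)
        = [set const_mx (1 / 2)]%classic].
Proof.
split; [exact: cvg_max_density | exact: paw_perfectly_stable | exact: maximizers_paw].
Qed.
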